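(* With the concept tensor $\mathbb{K}_1\otimes\mathbb{K}_2$ of formal contexts as tensor on objects, the assignment $(R_1\otimes R_2)(g_1,g_2)=\overline{R_1(g_1)\times R_2(g_2)}$ as tensor on morphisms, the trivial context $\mathbb{I}$ as tensor unit, and structure isomorphisms $\alpha\colon \mathbb{K}_1\otimes(\mathbb{K}_2\otimes\mathbb{K}_3)\to(\mathbb{K}_1\otimes\mathbb{K}_2)\otimes\mathbb{K}_3$, $\sigma\colon\mathbb{K}_1\otimes\mathbb{K}_2\to\mathbb{K}_2\otimes\mathbb{K}_1$, $\rho\colon\mathbb{K}_1\otimes\mathbb{I}\to\mathbb{K}_1$ given by $$\alpha(g_1,(g_2,g_3))=\overline{((g_1,g_2),g_3)},\qquad \sigma(g_1,g_2)=\overline{(g_2,g_1)},\qquad \rho(g_1,\star)=\overline{g_1}$$ (and the left unitor $\lambda\colon\mathbb{I}\otimes\mathbb{K}_1\to\mathbb{K}_1$ analogously), $(\mathbf{Cxt},\otimes,\mathbb{I})$ is a symmetric monoidal category.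
   Context: A formal context is a triple $\mathbb{K}=(G,M,\models)$ of a set $G$ (objects), a set $M$ (attributes) and a relation $\models\ \subseteq G\times M$. For $A\subseteq G$ put $A'=\{m\in M\mid a\models m\ \forall a\in A\}$, and for $B\subseteq M$ put $B'=\{g\in G\mid g\models b\ \forall b\in B\}$. The closure of a subset $A$ (of $G$ or of $M$) is $\overline{A}:=A''$; $A$ is closed if $A=\overline{A}$. Write $\overline{g}=\overline{\{g\}}$. For a relation $R\subseteq X\times Y$, written $R\colon X\to Y$, and $A\subseteq X$, let $R(A)=\{y\mid \exists a\in A,\ R(a,y)\}$, $R(x)=R(\{x\})$, and for $Z\subseteq Y$ let $R^\bullet(Z)=\{x\in X\mid R(x)\subseteq Z\}$. Category $\mathbf{Cxt}$: objects are formal contexts; morphisms $\mathbb{K}_1\to\mathbb{K}_2$ are closed relations $R\colon G_1\to G_2$, i.e. relations such that $R(g)$ is closed in $\mathbb{K}_2$ for every $g\in G_1$, and $R^\bullet$ sends closed subsets of $G_2$ to closed subsets of $G_1$. Composition is $(S\circ R)(g)=\overline{S(R(g))}$; the identity on $\mathbb{K}$ is $g\mapsto\overline{g}$. Concept tensor: $\mathbb{K}_1\otimes\mathbb{K}_2=(G_1\times G_2,\ M_1\times M_2,\ \triangledown)$ where $(g_1,g_2)\mathrel{\triangledown}(m_1,m_2)$ iff $g_1\models m_1$ or $g_2\models m_2$. For closed relations $R_1\colon\mathbb{K}_1\to\mathbb{K}_3$, $R_2\colon\mathbb{K}_2\to\mathbb{K}_4$, $R_1\otimes R_2\colon\mathbb{K}_1\otimes\mathbb{K}_2\to\mathbb{K}_3\otimes\mathbb{K}_4$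 is the relation given in the statement, the closure being taken in $\mathbb{K}_3\otimes\mathbb{K}_4$; the closures in the structure isomorphisms are taken in the codomain contexts. Trivial context: $\mathbb{I}=(\{\star\},\{\star\},\neq)$, so $\star\not\models\star$. *)

(* Defs.v *)
#[warnings="-notation-overridden"]
From mathcomp Require Import all_boot classical_sets.

Set Implicit Arguments.
Unset Strict Implicit.
Unset Printing Implicit Defensive.

Local Open Scope classical_set_scope.

Record category (ob : Type) (hom : ob -> ob -> Type) := Category {
  cat_id : forall a, hom a a;
  cat_comp : forall a b c, hom b c -> hom a b -> hom a c;
  cat_comp_idl : forall a b (f : hom a b), cat_comp (cat_id b) f = f;
  cat_comp_idr : forall a b (f : hom a b), cat_comp f (cat_id a) = f;
  cat_comp_assoc : forall a b c d (h : hom c d) (g : hom b c) (f : hom a b),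
    cat_comp h (cat_comp g f) = cat_comp (cat_comp h g) f
}.

Arguments cat_id {ob hom} _ a.
Arguments cat_comp {ob hom} _ {a b c} _ _.

Section SymmetricMonoidal.
Variables (ob : Type) (hom : ob -> ob -> Type) (C : category hom).

Definition cat_iso (a b : ob) (f : hom a b) : Prop :=
  exists g : hom b a, cat_comp C g f = cat_id C a /\ cat_comp C f g = cat_id C b.

Variables (tensor : ob -> ob -> ob) (unit_ob : ob).

Local Notation "a ⊗ b" := (tensor a b) (at level 40, left associativity).
Local Notation "g ∘ f" := (cat_comp C g f) (at level 50, left associativity).

(* Mac Lane's axioms, with his orientation a ⊗ (b ⊗ c) -> (a ⊗ b) ⊗ c of the
   associator.  [smc_unitlr] and [smc_braid_unit] are part of his definition,
   although they follow from the other axioms. *)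
Record symmetric_monoidal := SymmetricMonoidal {
  tensor_hom : forall a b c d, hom a c -> hom b d -> hom (a ⊗ b) (c ⊗ d);
  associator : forall a b c, hom (a ⊗ (b ⊗ c)) ((a ⊗ b) ⊗ c);
  left_unitor : forall a, hom (unit_ob ⊗ a) a;
  right_unitor : forall a, hom (a ⊗ unit_ob) a;
  braiding : forall a b, hom (a ⊗ b) (b ⊗ a);

  smc_tensor_id : forall a b,
    tensor_hom (cat_id C a) (cat_id C b) = cat_id C (a ⊗ b);
  smc_tensor_comp : forall a1 b1 c1 a2 b2 c2
      (g1 : hom b1 c1) (f1 : hom a1 b1) (g2 : hom b2 c2) (f2 : hom a2 b2),
    tensor_hom (g1 ∘ f1) (g2 ∘ f2) = tensor_hom g1 g2 ∘ tensor_hom f1 f2;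

  smc_associator_iso : forall a b c, cat_iso (associator a b c);
  smc_left_unitor_iso : forall a, cat_iso (left_unitor a);
  smc_right_unitor_iso : forall a, cat_iso (right_unitor a);
  smc_braiding_iso : forall a b, cat_iso (braiding a b);

  smc_associator_nat : forall a b c a' b' c'
      (f : hom a a') (g : hom b b') (h : hom c c'),
    associator a' b' c' ∘ tensor_hom f (tensor_hom g h) =
    tensor_hom (tensor_hom f g) h ∘ associator a b c;
  smc_left_unitor_nat : forall a a' (f : hom a a'),
    left_unitor a' ∘ tensor_hom (cat_id C unit_ob) f = f ∘ left_unitor a;
  smc_right_unitor_nat : forall a a' (f : hom a a'),
    right_unitor a' ∘ tensor_hom f (cat_id C unit_ob) = f ∘ right_unitor a;
  smc_braiding_nat : forall a b a' b' (f : hom a a') (g : hom b b'),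
    braiding a' b' ∘ tensor_hom f g = tensor_hom g f ∘ braiding a b;

  smc_pentagon : forall a b c d,
    associator (a ⊗ b) c d ∘ associator a b (c ⊗ d) =
    tensor_hom (associator a b c) (cat_id C d)
      ∘ associator a (b ⊗ c) d
      ∘ tensor_hom (cat_id C a) (associator b c d);
  smc_triangle : forall a c,
    tensor_hom (right_unitor a) (cat_id C c) ∘ associator a unit_ob c =
    tensor_hom (cat_id C a) (left_unitor c);
  smc_unitlr : left_unitor unit_ob = right_unitor unit_ob;

  smc_symmetry : forall a b, braiding b a ∘ braiding a b = cat_id C (a ⊗ b);
  smc_hexagon : forall a b c,
    associator c a b ∘ braiding (a ⊗ b) c ∘ associator a b c =
    tensor_hom (braiding a c) (cat_id C b)
      ∘ associator a c b
      ∘ tensor_hom (cat_id C a) (braiding b c);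
  smc_braid_unit : forall a,
    left_unitor a ∘ braiding a unit_ob = right_unitor a
}.

End SymmetricMonoidal.

Arguments tensor_hom {ob hom C tensor unit_ob} _ {a b c d} _ _.
Arguments associator {ob hom C tensor unit_ob} _ a b c.
Arguments left_unitor {ob hom C tensor unit_ob} _ a.
Arguments right_unitor {ob hom C tensor unit_ob} _ a.
Arguments braiding {ob hom C tensor unit_ob} _ a b.

Record context := Context {
  obj : Type;
  attr : Type;
  models : obj -> attr -> Prop
}.

Arguments models : clear implicits.

Section Derivation.
Variable K : context.

Definition intent (A : set (obj K)) : set (attr K) :=
  [set m | forall a, A a -> models K a m].

Definition extent (B : set (attr K)) : set (obj K) :=
  [set g | forall b, B b -> models K g b].

Definition cxt_closure (A : set (obj K)) : set (obj K) := extent (intent A).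

Definition cxt_closed (A : set (obj K)) : Prop := A = cxt_closure A.

End Derivation.

(* A relation R : X -> Y is a function X -> set Y, so that [R x] is R({x}). *)
Definition rel_image (X Y : Type) (R : X -> set Y) (A : set X) : set Y :=
  \bigcup_(a in A) R a.

Definition rel_bullet (X Y : Type) (R : X -> set Y) (Z : set Y) : set X :=
  [set x | R x `<=` Z].

Record closed_rel (K1 K2 : context) := ClosedRel {
  rel_of :> obj K1 -> set (obj K2);
  closed_rel_closed : forall g, cxt_closed (rel_of g);
  closed_rel_bullet : forall Z, cxt_closed Z -> cxt_closed (rel_bullet rel_of Z)
}.

Definition ctensor (K1 K2 : context) : context :=
  @Context (obj K1 * obj K2) (attr K1 * attr K2)
    (fun g m => models K1 g.1 m.1 \/ models K2 g.2 m.2).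

Definition cunit : context := @Context unit unit (fun g m => g <> m).

(* Main.v *)
(* A closed relation R is determined by its bond, the relation "R g is contained
   in the extent of m" between objects g and attributes m, whose columns must be
   closed.  On bonds the tensor is disjunction: a product A x B lies in
   (C x Y) u (X x D) iff A lies in C or B lies in D, and this also gives
   functoriality.  The structure isomorphisms all come from maps of objects that
   have an adjoint map of attributes; composing with such a map merely
   substitutes into a bond, so naturality becomes associativity, commutativity
   and unit laws of disjunction, and coherence an equality of maps of objects. *)

Require Import Defs.
From mathcomp Require Import ssreflect ssrfun ssrbool boolp classical_sets.

Set Implicit Arguments.
Unset Strict Implicit.
Unset Printing Implicit Defensive.

Local Open Scope classical_set_scope.

(** * Closures and closed sets *)

Lemma closureS (K : context) (A : set (obj K)) : A `<=` cxt_closure A.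
Proof. by move=> g Ag m; apply. Qed.

Lemma intent_closure (K : context) (A : set (obj K)) :
  intent (cxt_closure A) = intent A.
Proof.
apply/seteqP; split=> m Am g; last by apply.
by move=> Ag; apply: Am; exact: closureS.
Qed.

Lemma closedP (K : context) (A : set (obj K)) :
  cxt_closed A <-> cxt_closure A `<=` A.
Proof.
split=> [{2}->//|clA]; apply/seteqP; split => //; exact: closureS.
Qed.

Lemma closed_closure (K : context) (A : set (obj K)) :
  cxt_closed (cxt_closure A).
Proof. by rewrite /cxt_closed /cxt_closure -/(cxt_closure A) intent_closure. Qed.

Lemma closed_extent (K : context) (B : set (attr K)) : cxt_closed (extent B).
Proof. by apply/closedP => g clg b Bb; apply: clg => a; apply. Qed.

Lemma closure_sub (K : context) (A Z : set (obj K)) :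
  cxt_closed Z -> (cxt_closure A `<=` Z) <-> (A `<=` Z).
Proof.
move=> Zcl; split=> [clA g /closureS/clA//|AZ].
rewrite Zcl => g clg m Zm; apply: clg => a /AZ; exact: Zm.
Qed.

(** * Closed relations and their bonds *)

(* The bond of a closed relation: [R] is recovered from it as [R g] is closed. *)
Definition bond (K1 K2 : context) (R : obj K1 -> set (obj K2)) (g : obj K1) :
  set (attr K2) := intent (R g).

Lemma closed_rel_ext (K1 K2 : context) (R S : closed_rel K1 K2) :
  (forall g m, bond R g m <-> bond S g m) -> R = S.
Proof.
move=> RS; have {RS} : rel_of R = rel_of S.
  apply: funext => g; rewrite (closed_rel_closed R g) (closed_rel_closed S g).
  by rewrite /cxt_closure; congr extent; apply/seteqP; split=> m /RS.
case: R S => [R R1 R2] [S S1 S2] /= RS; subst S.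
by congr ClosedRel; exact: Prop_irrelevance.
Qed.

Definition bond_closed (K1 K2 : context) (R : obj K1 -> set (obj K2)) :=
  forall m, cxt_closed [set g | bond R g m].

(** The column of the bond at [m] is [rel_bullet R] of the extent of [m], and that extent is
    closed. *)
Lemma closed_rel_bond (K1 K2 : context) (R : closed_rel K1 K2) : bond_closed R.
Proof.
move=> m; have := closed_rel_bullet R (closed_extent [set m]).
congr cxt_closed; apply/seteqP; split=> g Rg h; first by move/Rg; apply.
by move=> /Rg ? _ ->.
Qed.

Section Generate.
Variables (K1 K2 : context) (R : obj K1 -> set (obj K2)).
Hypothesis R_bond : bond_closed R.

(** Key to the converse of [closed_rel_bond]. A closed [Z] is the intersection of the extents of the
    attributes in [intent Z], so its preimage is the intersection of the corresponding columns of
    the bond. *)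
Lemma generate_bullet Z :
  cxt_closed Z -> cxt_closed (rel_bullet (fun g => cxt_closure (R g)) Z).
Proof.
move=> Zcl; apply/closedP => g clg.
apply/(closure_sub (R g) Zcl); rewrite Zcl => h Rh m Zm.
have/closedP R_m := R_bond m.
apply: (R_m g) Rh => n Rn; apply: clg => a /(closure_sub (R a) Zcl) RaZ.
by apply: Rn => b /RaZ; exact: Zm.
Qed.

Definition generate : closed_rel K1 K2 :=
  ClosedRel (fun g => closed_closure (R g)) generate_bullet.

Lemma bond_generate g m : bond generate g m <-> bond R g m.
Proof. by rewrite /bond /= intent_closure. Qed.

End Generate.

(** * Composition of closed relations *)

Section Composition.
Variables (K1 K2 K3 : context) (S : closed_rel K2 K3) (R : closed_rel K1 K2).

Lemma bond_image g m :
  bond (fun g => rel_image S (R g)) g m <-> R g `<=` [set h | bond S h m].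
Proof.
split=> [H h Rh k Sk|H k [h Rh]]; first by apply: H; exists h.
exact: H.
Qed.

(** The column at [m] is [rel_bullet R] of the column of [S] at [m]. *)
Lemma image_bond_closed : bond_closed (fun g => rel_image S (R g)).
Proof.
move=> m; have := closed_rel_bullet R (closed_rel_bond S m).
by congr cxt_closed; apply/seteqP; split=> g /bond_image.
Qed.

Definition ccomp := generate image_bond_closed.

Lemma bond_comp g m : bond ccomp g m <-> R g `<=` [set h | bond S h m].
Proof. exact: iff_trans (bond_generate _ g m) (bond_image g m). Qed.

End Composition.

(** * Chu morphisms and the category of contexts *)

(* A morphism of contexts regarded as Chu spaces with values in [Prop]; its
   bond is [models K2 (chu_obj F g) m].  All the structure morphisms of the
   monoidal category are of this form. *)
Record chu (K1 K2 : context) := Chu {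
  chu_obj : obj K1 -> obj K2;
  chu_attr : attr K2 -> attr K1;
  chuP : forall g m, models K2 (chu_obj g) m <-> models K1 g (chu_attr m)
}.

Section ChuRelation.
Variables (K1 K2 : context) (F : chu K1 K2).

Lemma bond_set1 g m :
  bond (fun g => [set chu_obj F g]) g m <-> models K2 (chu_obj F g) m.
Proof. by split=> [H|H _ ->//]; exact: H. Qed.

Lemma chu_bond_closed : bond_closed (fun g => [set chu_obj F g]).
Proof.
move=> m; have := closed_extent [set chu_attr F m].
congr cxt_closed; apply/seteqP; split=> g.
  by move=> H; apply/bond_set1/chuP; exact: H.
by move=> /bond_set1/chuP ? _ ->.
Qed.

Definition chu_rel := generate chu_bond_closed.

Lemma bond_chu g m : bond chu_rel g m <-> models K2 (chu_obj F g) m.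
Proof. exact: iff_trans (bond_generate _ g m) (bond_set1 g m). Qed.

End ChuRelation.

Lemma bond_comp_chul (K1 K2 K3 : context) (F : chu K2 K3)
    (R : closed_rel K1 K2) g m :
  bond (ccomp (chu_rel F) R) g m <-> bond R g (chu_attr F m).
Proof.
split=> [/bond_comp H h /H/bond_chu/chuP//|H].
by apply/bond_comp => h /H Hh; apply/bond_chu/chuP.
Qed.

(** The columns of [S] are closed, so on the closure of a single object only that object has to be
    tested. *)
Lemma bond_comp_chur (K1 K2 K3 : context) (S : closed_rel K2 K3)
    (F : chu K1 K2) g m :
  bond (ccomp S (chu_rel F)) g m <-> bond S (chu_obj F g) m.
Proof.
split=> [/bond_comp H|H]; first by apply: H; exact: closureS.
apply/bond_comp/(closure_sub _ (closed_rel_bond S m)) => _ -> //.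
Qed.

(** The attribute map only ensures that the columns are closed; the bond mentions the object map
    alone. *)
Lemma chu_rel_ext (K1 K2 : context) (F G : chu K1 K2) :
  chu_obj F =1 chu_obj G -> chu_rel F = chu_rel G.
Proof.
move=> FG; apply: closed_rel_ext => g m.
by split=> /bond_chu H; apply/bond_chu; rewrite ?FG // -FG.
Qed.

Definition chu_id (K : context) : chu K K :=
  @Chu K K id id (fun _ _ => iff_refl _).

Definition cid (K : context) := chu_rel (chu_id K).

Lemma chu_compP (K1 K2 K3 : context) (G : chu K2 K3) (F : chu K1 K2) g m :
  models K3 (chu_obj G (chu_obj F g)) m <->
  models K1 g (chu_attr F (chu_attr G m)).
Proof. exact: iff_trans (chuP G _ _) (chuP F _ _). Qed.

Definition chu_comp (K1 K2 K3 : context) (G : chu K2 K3) (F : chu K1 K2) :=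
  Chu (chu_compP G F).

Lemma chu_rel_comp (K1 K2 K3 : context) (G : chu K2 K3) (F : chu K1 K2) :
  ccomp (chu_rel G) (chu_rel F) = chu_rel (chu_comp G F).
Proof.
apply: closed_rel_ext => g m.
apply: iff_trans (bond_comp_chur _ _ g m) _.
exact: iff_trans (bond_chu _ _ _) (iff_sym (bond_chu (chu_comp G F) g m)).
Qed.

Lemma ccomp_idl (K1 K2 : context) (R : closed_rel K1 K2) :
  ccomp (cid K2) R = R.
Proof. by apply: closed_rel_ext => g m; exact: bond_comp_chul. Qed.

Lemma ccomp_idr (K1 K2 : context) (R : closed_rel K1 K2) :
  ccomp R (cid K1) = R.
Proof. by apply: closed_rel_ext => g m; exact: bond_comp_chur. Qed.

(** The closures taken in the inner composites are invisible to closed columns, which leaves the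
    associativity of plain relational composition. *)
Lemma ccomp_assoc (K1 K2 K3 K4 : context) (T : closed_rel K3 K4)
    (S : closed_rel K2 K3) (R : closed_rel K1 K2) :
  ccomp T (ccomp S R) = ccomp (ccomp T S) R.
Proof.
apply: closed_rel_ext => g m; split.
  move=> /bond_comp H; apply/bond_comp => h Rh; apply/bond_comp => k Sk.
  by apply: H; apply: closureS; exists h.
move=> /bond_comp H; apply/bond_comp.
apply/(closure_sub _ (closed_rel_bond T m)) => k [h Rh Sk].
by move/H/bond_comp: Rh; exact.
Qed.

Definition cxt_category : category closed_rel :=
  Category ccomp_idl ccomp_idr ccomp_assoc.

(** * The tensor product of closed relations *)

(** Classical: an [x] in [A] outside [P] forces every [y] in [B] into [Q]. It is applied to objects
    as well as to attributes. *)
Lemma forall_or (X Y : Type) (A P : set X) (B Q : set Y) :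
  (forall x y, A x -> B y -> P x \/ Q y) <-> (A `<=` P \/ B `<=` Q).
Proof.
split=> [H|[AP x y /AP|BQ x y _ /BQ]]; [|by left|by right].
have [AP|nAP] := pselect (A `<=` P); [by left|right=> y By].
apply: contrapT => nQy; apply: nAP => x Ax.
by case: (H x y Ax By).
Qed.

Section Tensor.
Variables (K1 K2 K3 K4 : context).
Variables (R1 : closed_rel K1 K3) (R2 : closed_rel K2 K4).

Definition rel_prod (p : obj (ctensor K1 K2)) : set (obj (ctensor K3 K4)) :=
  R1 p.1 `*` R2 p.2.

Lemma bond_prod p m :
  bond rel_prod p m <-> bond R1 p.1 m.1 \/ bond R2 p.2 m.2.
Proof.
split=> [H|/forall_or H [x y] [/= Rx Ry]]; last exact: H.
by apply/forall_or => x y Rx Ry; exact: (H (x, y)).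
Qed.

Lemma prod_bond_closed : bond_closed rel_prod.
Proof.
move=> m; apply/closedP => -[g1 g2] clg; apply/bond_prod => /=.
have/closedP R1m := closed_rel_bond R1 m.1.
have/closedP R2m := closed_rel_bond R2 m.2.
(* Every pair [(m1, m2)] from the two intents lies in the intent of the column at [m], so [(g1, g2)]
   satisfies it; [forall_or] then selects one factor that works for all pairs. *)
have: intent [set g | bond R1 g m.1] `<=` [set m1 | models K1 g1 m1] \/
      intent [set g | bond R2 g m.2] `<=` [set m2 | models K2 g2 m2].
  apply/forall_or => m1 m2 Hm1 Hm2; apply: (clg (m1, m2)) => -[a1 a2].
  by case/bond_prod => [/Hm1|/Hm2]; [left|right].
by case=> [/R1m|/R2m]; [left|right].
Qed.

Definition ctensor_hom := generate prod_bond_closed.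

Lemma bond_tensor p m :
  bond ctensor_hom p m <-> bond R1 p.1 m.1 \/ bond R2 p.2 m.2.
Proof. exact: iff_trans (bond_generate _ p m) (bond_prod p m). Qed.

End Tensor.

Section ChuTensor.
Variables (K1 K2 K3 K4 : context) (F : chu K1 K3) (G : chu K2 K4).

Lemma chu_tensorP (p : obj (ctensor K1 K2)) (m : attr (ctensor K3 K4)) :
  models (ctensor K3 K4) (chu_obj F p.1, chu_obj G p.2) m <->
  models (ctensor K1 K2) p (chu_attr F m.1, chu_attr G m.2).
Proof. by split=> -[/chuP|/chuP]; [left|right|left|right]. Qed.

Definition chu_tensor : chu (ctensor K1 K2) (ctensor K3 K4) := Chu chu_tensorP.

Lemma chu_rel_tensor :
  ctensor_hom (chu_rel F) (chu_rel G) = chu_rel chu_tensor.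
Proof.
apply: closed_rel_ext => p m; split.
  by move=> /bond_tensor H; apply/bond_chu; case: H => /bond_chu; [left|right].
by move=> /bond_chu H; apply/bond_tensor; case: H => ?; [left|right];
  apply/bond_chu.
Qed.

End ChuTensor.

Lemma ctensor_comp (A1 B1 C1 A2 B2 C2 : context)
    (S1 : closed_rel B1 C1) (R1 : closed_rel A1 B1)
    (S2 : closed_rel B2 C2) (R2 : closed_rel A2 B2) :
  ctensor_hom (ccomp S1 R1) (ccomp S2 R2) =
  ccomp (ctensor_hom S1 S2) (ctensor_hom R1 R2).
Proof.
apply: closed_rel_ext => p m; split.
  move=> /bond_tensor H; apply/bond_comp.
  (* The column is closed, so it suffices to test the product itself instead of its closure. *)
  apply/(closure_sub _ (closed_rel_bond _ m)) => -[h1 h2] [/= Rh1 Rh2].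
  apply/bond_tensor.
  by case: H => /bond_comp; [move/(_ _ Rh1); left|move/(_ _ Rh2); right].
move=> /bond_comp H; apply/bond_tensor.
have/forall_or : forall h1 h2, R1 p.1 h1 -> R2 p.2 h2 ->
    bond S1 h1 m.1 \/ bond S2 h2 m.2.
  move=> h1 h2 Rh1 Rh2; apply/(bond_tensor S1 S2 (h1, h2)).
  by apply: H; apply: closureS.
by case=> ?; [left|right]; apply/bond_comp.
Qed.

(** * Structure isomorphisms and their naturality *)

Lemma chu_rel_iso (K1 K2 : context) (F : chu K1 K2) (G : chu K2 K1) :
  cancel (chu_obj F) (chu_obj G) -> cancel (chu_obj G) (chu_obj F) ->
  cat_iso cxt_category (chu_rel F).
Proof.
by move=> FK GK; exists (chu_rel G); split; rewrite /= chu_rel_comp;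
  exact: chu_rel_ext.
Qed.

Section StructureMaps.
Variables K1 K2 K3 : context.

(** The two maps stay transparent, so that coherence equations hold by computation on tuples;
    [abstract] seals only the adjunction proof. *)
Definition chu_assoc :
  chu (ctensor K1 (ctensor K2 K3)) (ctensor (ctensor K1 K2) K3).
Proof.
refine (@Chu (ctensor K1 (ctensor K2 K3)) (ctensor (ctensor K1 K2) K3)
  (fun p => ((p.1, p.2.1), p.2.2)) (fun m => (m.1.1, (m.1.2, m.2))) _).
abstract (move=> g m /=; tauto).
Defined.

Definition chu_assoc_inv :
  chu (ctensor (ctensor K1 K2) K3) (ctensor K1 (ctensor K2 K3)).
Proof.
refine (@Chu (ctensor (ctensor K1 K2) K3) (ctensor K1 (ctensor K2 K3))
  (fun p => (p.1.1, (p.1.2, p.2))) (fun m => ((m.1, m.2.1), m.2.2)) _).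
abstract (move=> g m /=; tauto).
Defined.

Definition chu_swap : chu (ctensor K1 K2) (ctensor K2 K1).
Proof.
refine (@Chu (ctensor K1 K2) (ctensor K2 K1)
  (fun p => (p.2, p.1)) (fun m => (m.2, m.1)) _).
abstract (move=> g m /=; tauto).
Defined.

(** This makes [cunit] neutral for the tensor, as [False] is for disjunction. *)
Lemma cunit_models (x y : unit) : models cunit x y <-> False.
Proof. by case: x y => -[]; split. Qed.

Definition chu_unitr : chu (ctensor K1 cunit) K1.
Proof.
refine (@Chu (ctensor K1 cunit) K1 fst (fun m => (m, tt)) _).
abstract (by move=> g m; split=> [|[//|/cunit_models//]]; left).
Defined.

Definition chu_unitr_inv : chu K1 (ctensor K1 cunit).
Proof.
refine (@Chu K1 (ctensor K1 cunit) (fun g => (g, tt)) fst _).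
abstract (by move=> g m; split=> [[//|/cunit_models//]|]; left).
Defined.

Definition chu_unitl : chu (ctensor cunit K1) K1.
Proof.
refine (@Chu (ctensor cunit K1) K1 snd (fun m => (tt, m)) _).
abstract (by move=> g m; split=> [|[/cunit_models//|//]]; right).
Defined.

Definition chu_unitl_inv : chu K1 (ctensor cunit K1).
Proof.
refine (@Chu K1 (ctensor cunit K1) (fun g => (tt, g)) snd _).
abstract (by move=> g m; split=> [[/cunit_models//|//]|]; right).
Defined.

End StructureMaps.

Lemma chu_assoc_nat (A B C A' B' C' : context)
    (f : closed_rel A A') (g : closed_rel B B') (h : closed_rel C C') :
  ccomp (chu_rel (chu_assoc A' B' C')) (ctensor_hom f (ctensor_hom g h)) =
  ccomp (ctensor_hom (ctensor_hom f g) h) (chu_rel (chu_assoc A B C)).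
Proof.
apply: closed_rel_ext => p m; rewrite bond_comp_chul bond_comp_chur.
by rewrite !bond_tensor /= or_assoc.
Qed.

Lemma chu_swap_nat (A B A' B' : context)
    (f : closed_rel A A') (g : closed_rel B B') :
  ccomp (chu_rel (chu_swap A' B')) (ctensor_hom f g) =
  ccomp (ctensor_hom g f) (chu_rel (chu_swap A B)).
Proof.
apply: closed_rel_ext => p m; rewrite bond_comp_chul bond_comp_chur.
by rewrite !bond_tensor /= or_comm.
Qed.

Lemma bond_cunit x y : ~ bond (cid cunit) x y.
Proof. by move/bond_chu/cunit_models. Qed.

Lemma chu_unitr_nat (A A' : context) (f : closed_rel A A') :
  ccomp (chu_rel (chu_unitr A')) (ctensor_hom f (cid cunit)) =
  ccomp f (chu_rel (chu_unitr A)).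
Proof.
apply: closed_rel_ext => p m; rewrite bond_comp_chul bond_comp_chur.
by rewrite bond_tensor /=; split=> [[//|/bond_cunit//]|]; left.
Qed.

Lemma chu_unitl_nat (A A' : context) (f : closed_rel A A') :
  ccomp (chu_rel (chu_unitl A')) (ctensor_hom (cid cunit) f) =
  ccomp f (chu_rel (chu_unitl A)).
Proof.
apply: closed_rel_ext => p m; rewrite bond_comp_chul bond_comp_chur.
by rewrite bond_tensor /=; split=> [[/bond_cunit//|//]|]; right.
Qed.

(** * The symmetric monoidal structure *)

Definition cxt_symmetric_monoidal :
  symmetric_monoidal cxt_category ctensor cunit.
Proof.
apply: (@SymmetricMonoidal _ _ cxt_category _ _ ctensor_hom
  (fun a b c => chu_rel (chu_assoc a b c)) (fun a => chu_rel (chu_unitl a))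
  (fun a => chu_rel (chu_unitr a)) (fun a b => chu_rel (chu_swap a b))).
all: rewrite /= /cid; intros.
(* Each side of a coherence axiom collapses to a single [chu_rel], and the object maps are compared
   by cases on tuples. Functoriality on composites, invertibility and naturality remain. *)
all: rewrite ?chu_rel_tensor ?chu_rel_comp ?chu_rel_tensor ?chu_rel_comp.
all: try by apply: chu_rel_ext; do ?case.
- exact: ctensor_comp.
- by apply: (chu_rel_iso (G := chu_assoc_inv a b c)) => [[? []]|[[]]].
- by apply: (chu_rel_iso (G := chu_unitl_inv a)) => // -[[]].
- by apply: (chu_rel_iso (G := chu_unitr_inv a)) => // -[? []].
- by apply: (chu_rel_iso (G := chu_swap b a)) => -[].
- exact: chu_assoc_nat.
- exact: chu_unitl_nat.
- exact: chu_unitr_nat.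
- exact: chu_swap_nat.
Defined.

Theorem theorem21 :
  exists (C : category closed_rel) (T : symmetric_monoidal C ctensor cunit),
    (forall (K : context) (g : obj K), cat_id C K g = cxt_closure [set g]) /\
    (forall (K1 K2 K3 : context) (S : closed_rel K2 K3) (R : closed_rel K1 K2)
        (g : obj K1),
      cat_comp C S R g = cxt_closure (rel_image S (R g))) /\
    (forall (K1 K2 K3 K4 : context) (R1 : closed_rel K1 K3)
        (R2 : closed_rel K2 K4) (g1 : obj K1) (g2 : obj K2),
      tensor_hom T R1 R2 (g1, g2) =
      cxt_closure (K := ctensor K3 K4) (R1 g1 `*` R2 g2)) /\
    (forall (K1 K2 K3 : context) (g1 : obj K1) (g2 : obj K2) (g3 : obj K3),
      associator T K1 K2 K3 (g1, (g2, g3)) =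
      cxt_closure (K := ctensor (ctensor K1 K2) K3) [set ((g1, g2), g3)]) /\
    (forall (K1 K2 : context) (g1 : obj K1) (g2 : obj K2),
      braiding T K1 K2 (g1, g2) = cxt_closure (K := ctensor K2 K1) [set (g2, g1)]) /\
    (forall (K1 : context) (g1 : obj K1),
      right_unitor T K1 (g1, tt) = cxt_closure [set g1]) /\
    (forall (K1 : context) (g1 : obj K1),
      left_unitor T K1 (tt, g1) = cxt_closure [set g1]).
Proof.
(* The formulas hold by computation, since [generate] is the pointwise closure. *)
by exists cxt_category, cxt_symmetric_monoidal.
Qed.
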